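(* The set of eigenvalues of $\operatorname{Re}(V^2)$ is $$\left\{\frac{1}{4t^2}:t>0,\ \frac{\coth t}{t}=1\right\}\cup\left\{-\frac{1}{4t^2}:t>0,\ \frac{\cot t}{t}=-1\right\}\cup\left\{-\frac{1}{(2n+1)^2\pi^2}:n\in\mathbb{Z}\right\}.$$
   Context: $L^2[0,1]$ is the complex Hilbert space of square-integrable functions on $[0,1]$. The Volterra operator $V:L^2[0,1]\to L^2[0,1]$ is defined by $Vf(x):=\int_0^x f(t)\,dt$, and its adjoint is $V^*f(x)=\int_x^1 f(t)\,dt$. The real part of $V^2$ is $\operatorname{Re}(V^2):=(V^2+V^{*2})/2$, where $V^{*2}:=(V^* )^2$. *)

(* Defs.v *)
From HB Require Import structures.
From mathcomp Require Import all_boot all_order all_algebra.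
From mathcomp Require Import all_classical all_reals all_analysis.
From mathcomp Require Import complex.

Set Implicit Arguments.
Unset Strict Implicit.
Unset Printing Implicit Defensive.

Import Order.TTheory GRing.Theory Num.Theory.
Import numFieldNormedType.Exports.

Local Open Scope classical_set_scope.
Local Open Scope ring_scope.
Local Open Scope complex_scope.

Section Hyperbolic.
Context {R : realType}.
Implicit Types t : R.

Definition sinh t : R := (expR t - expR (- t)) / 2.
Definition cosh t : R := (expR t + expR (- t)) / 2.
Definition coth t : R := cosh t / sinh t.

(* As division by 0 yields 0, cot t = 0 at the zeros t of sin. *)
Definition cot t : R := cos t / sin t.

End Hyperbolic.

(* Elements of L^2[0,1] are represented by functions f : R -> R[i], of which
   only the values on [0,1] are relevant, up to almost-everywhere equality on
   [0,1]. *)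
Section Volterra.
Context {R : realType}.
Local Notation mu := (@lebesgue_measure R).
Implicit Types (f g : R -> R[i]) (D : set R).

Definition cmeasurable_fun D f : Prop :=
  measurable_fun D (fun x => complex.Re (f x)) /\
  measurable_fun D (fun x => complex.Im (f x)).

Definition Cintegral D f : R[i] :=
  (\int[mu]_(t in D) complex.Re (f t)) +i* (\int[mu]_(t in D) complex.Im (f t)).

Definition L2_01 f : Prop :=
  cmeasurable_fun `[0, 1] f /\
  (\int[mu]_(x in `[0%R, 1%R]) ((Normc.normc (f x)) ^+ 2)%:E < +oo)%E.

Definition L2_eq f g : Prop := f = g %[ae mu in (`[0, 1]%classic : set R)].

Definition volterra f : R -> R[i] := fun x => Cintegral `[0, x] f.

Definition volterra_adj f : R -> R[i] := fun x => Cintegral `[x, 1] f.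

Definition Re_volterra2 f : R -> R[i] := fun x =>
  (volterra (volterra f) x + volterra_adj (volterra_adj f) x) / 2.

Definition is_eigenvalue (T : (R -> R[i]) -> (R -> R[i])) (lambda : R[i]) :=
  exists f, [/\ L2_01 f, ~ L2_eq f (fun=> 0)
                       & L2_eq (T f) (fun x => lambda * f x)].

End Volterra.

(* Main.v *)
(* On real functions Re(V^2) is the integral operator T with kernel |x - t| / 2.
   Every h = T u satisfies h'' = u together with h'(0) = - h'(1) and
   h(0) + h(1) = h'(1), and these conditions determine T u.  Hence T is injective,
   and its eigenvalues are the 1/c for which h'' = c h has a non-zero solution
   under these boundary conditions.  Such a c is real, because the Wronskian of
   the real and imaginary parts of h takes equal values at 0 and 1 while its
   derivative is -(Im c) |h|^2.  For c = +-4 t^2, constancy of the Wronskians of h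
   with cosh(t(2x-1)) and sinh(t(2x-1)), respectively cos and sin, reduces
   solvability to t sinh t = cosh t, respectively t sin t = - cos t or
   cos t = 0. *)
Require Import Defs.
From mathcomp Require Import all_boot all_order all_algebra.
From mathcomp Require Import all_classical all_reals all_analysis complex.
From mathcomp Require Import measurable_realfun zify ring lra.
Import Order.TTheory GRing.Theory Num.Theory.
Import numFieldNormedType.Exports.
Local Open Scope classical_set_scope.
Local Open Scope ring_scope.
Local Open Scope complex_scope.

Set Implicit Arguments.
Unset Strict Implicit.

(** * Uniqueness and Wronskian identities for the boundary value problem on [0,1] *)

Section BoundaryValueProblem.
Context {R : realType}.
Implicit Types (h k g u v : R -> R) (c : R).

Lemma is_derive0_within_cst (f : R -> R) (a b : R) :
  (forall x : R, a < x < b -> is_derive x 1 f 0) ->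
  {within `[a, b], continuous f} ->
  forall x y, a <= x <= b -> a <= y <= b -> f x = f y.
Proof.
move=> df cf x y; wlog xy : x y / x <= y => [H|/andP[ax xb] /andP[ay yb]].
  by case: (leP x y) => [/H//|/ltW yx x01 y01]; rewrite (H y x).
have [||c _ /eqP] := @MVT_segment R f (fun=> 0) x y xy.
- move=> z; rewrite in_itv/= => /andP[xz zy]; apply: df.
  by rewrite (le_lt_trans ax xz) (lt_le_trans zy yb).
- apply: continuous_subspaceW cf => z /=; rewrite !in_itv/= => /andP[xz zy].
  by rewrite (le_trans ax xz) (le_trans zy yb).
by rewrite mul0r subr_eq0 => /eqP.
Qed.

Lemma near01 (x : R) : 0 < x < 1 -> \forall z \near x, 0 < z < 1.
Proof.
move=> /andP[x0 x1]; near=> z; apply/andP; split; near: z.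
  exact: lt_nbhsr.
exact: lt_nbhsl.
Unshelve. all: by end_near. Qed.

Lemma is_derive_near_cst (f : R -> R) (c x : R) :
  (forall y, 0 < y < 1 -> f y = c) -> 0 < x < 1 -> is_derive x 1 f 0.
Proof.
move=> fc x01; apply: (@near_eq_is_derive _ _ _ (cst c)) => //.
by near=> z; rewrite fc//; near: z; exact: near01.
Unshelve. all: by end_near. Qed.

(** Continuity up to the boundary carries the vanishing to the endpoints: [f] is constant on [0,1],
    so it takes its value at the interior point 1/2 everywhere. *)
Lemma within_continuous0 (f : R -> R) : (forall x, 0 < x < 1 -> f x = 0) ->
  {within `[0, 1], continuous f} -> forall x, 0 <= x <= 1 -> f x = 0.
Proof.
move=> f0 cf x x01; rewrite (@is_derive0_within_cst f 0 1 _ cf x 2^-1)//.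
- by rewrite f0//; lra.
- by move=> y; exact: is_derive_near_cst f0.
- by lra.
Qed.

Lemma continuous_itv01 (f : R -> R) (x : R) :
  {within `[0, 1], continuous f} -> 0 < x < 1 -> {for x, continuous f}.
Proof.
by move=> cf x01; apply: (within_continuous_continuous ltr01 cf); rewrite in_itv.
Qed.

Lemma within_continuousM (A : set R) (f g : R -> R) :
  {within A, continuous f} -> {within A, continuous g} ->
  {within A, continuous (fun x => f x * g x)}.
Proof. by move=> cf cg x; apply: cvgM; [exact: cf|exact: cg]. Qed.

Lemma within_continuous_lin (A : set R) (f g : R -> R) (a b : R) :
  {within A, continuous f} -> {within A, continuous g} ->
  {within A, continuous (fun x => a * f x + b * g x)}.
Proof.
move=> cf cg; apply: within_continuousD; apply: within_continuousM => //;
  exact/continuous_subspaceT/cst_continuous.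
Qed.

(* h'' = g with h' = k, under the boundary conditions satisfied by every function
   in the range of Re(V^2), see [bvp_rV2]. *)
Definition bvp h k g : Prop :=
  [/\ {within `[0, 1], continuous h}, {within `[0, 1], continuous k},
      forall x : R, 0 < x < 1 -> is_derive x 1 h (k x),
      forall x : R, 0 < x < 1 -> is_derive x 1 k (g x) &
      k 0 = - k 1 /\ h 0 + h 1 = k 1].

Lemma bvp_lin a b h1 k1 g1 h2 k2 g2 : bvp h1 k1 g1 -> bvp h2 k2 g2 ->
  bvp (fun x => a * h1 x + b * h2 x) (fun x => a * k1 x + b * k2 x)
      (fun x => a * g1 x + b * g2 x).
Proof.
move=> [ch1 ck1 dh1 dk1 [A1 B1]] [ch2 ck2 dh2 dk2 [A2 B2]]; split.
- exact: within_continuous_lin.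
- exact: within_continuous_lin.
- move=> x x01; have := dh1 x x01; have := dh2 x x01 => ? ?.
  apply: is_derive_eq; rewrite /GRing.scale/=; ring.
- move=> x x01; have := dk1 x x01; have := dk2 x x01 => ? ?.
  apply: is_derive_eq; rewrite /GRing.scale/=; ring.
- split; first by rewrite A1 A2; ring.
  by rewrite -B1 -B2; ring.
Qed.

(** Uniqueness: [k] is constant, hence 0 because k(0) = - k(1); then [h] is constant, hence 0
    because h(0) + h(1) = k(1) = 0. *)
Lemma bvp0 h k g : (forall x, 0 < x < 1 -> g x = 0) -> bvp h k g ->
  forall x, 0 <= x <= 1 -> h x = 0.
Proof.
move=> g0 [ch ck dh dk [k01 h01]] x x01.
have kE y : 0 <= y <= 1 -> k y = k 0.
  move=> y01; apply: (@is_derive0_within_cst k 0 1) => //.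
    by move=> z z01; rewrite -(g0 z z01); exact: dk.
  by lra.
have k0 y : 0 <= y <= 1 -> k y = 0.
  by move=> y01; rewrite kE//; have := kE 1; rewrite ler01 lexx => /(_ isT); lra.
have hE y : 0 <= y <= 1 -> h x = h y.
  move=> y01; apply: (@is_derive0_within_cst h 0 1) => //.
  move=> z z01; rewrite -(k0 z); first exact: dh.
  by case/andP: z01 => *; lra.
have /hE E0 : 0 <= (0 : R) <= 1 by lra.
have /hE E1 : 0 <= (1 : R) <= 1 by lra.
by have := k0 1; rewrite ler01 lexx => /(_ isT); lra.
Qed.

(** [P] solves the same equation as [h], so the two terms containing [c] cancel in the derivative of
    the Wronskian. *)
Lemma bvp_wronskian c h k (P Q : R -> R) : bvp h k (fun x => c * h x) ->
  (forall x : R, is_derive x 1 P (Q x)) ->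
  (forall x : R, is_derive x 1 Q (c * P x)) ->
  forall x y, 0 <= x <= 1 -> 0 <= y <= 1 ->
    h x * Q x - k x * P x = h y * Q y - k y * P y.
Proof.
move=> [ch ck dh dk _] dP dQ.
have cont (f f' : R -> R) : (forall x : R, is_derive x 1 f (f' x)) ->
    {within `[0, 1], continuous f}.
  by move=> df; apply: derivable_within_continuous => x _; case: (df x).
apply: (@is_derive0_within_cst (fun x => h x * Q x - k x * P x)) => [x x01|].
  have := dh x x01; have := dk x x01 => ? ?.
  apply: is_derive_eq; rewrite /GRing.scale/=; ring.
apply: within_continuousB; apply: within_continuousM => //; exact: cont.
Qed.

End BoundaryValueProblem.

(** * The integral operator on real functions: regularity, injectivity, and its link with the
    boundary value problem *)

Section RealOperator.
Context {R : realType}.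
Local Notation mu := (@lebesgue_measure R).
Implicit Types (h k g u v : R -> R) (c x : R).

Definition prim u x : R := \int[mu]_(t in `[0, x]) u t.

Definition rV2 u x : R :=
  (prim (prim u) x + \int[mu]_(s in `[x, 1]) \int[mu]_(t in `[s, 1]) u t) / 2.

Definition integrable01 u := mu.-integrable `[0, 1] (EFin \o u).

Lemma integrable01_continuous u :
  {within `[0, 1], continuous u} -> integrable01 u.
Proof.
by move=> cu; apply: continuous_compact_integrable => //; exact: segment_compact.
Qed.

Lemma prim_continuous u : integrable01 u -> {within `[0, 1], continuous (prim u)}.
Proof. exact: parameterized_integral_continuous. Qed.

Lemma is_derive_prim u x : integrable01 u -> 0 < x < 1 ->
  {for x, continuous u} -> is_derive x 1 (prim u) (u x).
Proof.
move=> iu /andP[x0 x1] cu.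
have [dp pE] := @continuous_FTC1_closed _ u 0 x 1 x1 iu x0 cu.
by apply: DeriveDef; [exact: dp|rewrite -pE derive1E].
Qed.

Lemma prim0 u : prim u 0 = 0.
Proof. by rewrite /prim set_itv1 Rintegral_set1. Qed.

Lemma integral_x1 u x : integrable01 u -> 0 <= x <= 1 ->
  \int[mu]_(t in `[x, 1]) u t = prim u 1 - prim u x.
Proof.
move=> iu /andP[x0 x1]; rewrite /prim Rintegral_itvB ?bnd_simp//.
rewrite Rintegral_itv_obnd_cbnd//; apply: integrableS iu => //.
by apply: subset_itvr; rewrite bnd_simp.
Qed.

Lemma eq_prim u v x : 0 <= x <= 1 -> (forall t, 0 <= t <= 1 -> u t = v t) ->
  prim u x = prim v x.
Proof.
move=> /andP[x0 x1] uv; apply: eq_Rintegral => t; rewrite inE/= in_itv/=.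
by move=> /andP[t0 tx]; rewrite uv// t0 (le_trans tx).
Qed.

(** The inner integral over [s,1] is [prim u 1 - prim u s]; integrating it over [x,1] leaves one
    double primitive and an affine function of [x], which is easy to differentiate. *)
Lemma rV2E u x : integrable01 u -> 0 <= x <= 1 ->
  rV2 u x = prim (prim u) x + (prim u 1 * (1 - x) - prim (prim u) 1) / 2.
Proof.
move=> iu x01; have /andP[x0 x1] := x01.
have ip := integrable01_continuous (prim_continuous iu).
rewrite /rV2; under [X in prim _ _ + X]eq_Rintegral => s.
  rewrite inE/= in_itv/= => /andP[xs s1].
  rewrite integral_x1//; last by rewrite (le_trans x0 xs).
  over.
have ipx : mu.-integrable `[x, 1] (EFin \o prim u).
  by apply: integrableS ip => //; apply: subset_itvr; rewrite bnd_simp.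
rewrite RintegralB//; last first.
  exact/continuous_compact_integrable/continuous_subspaceT/cst_continuous/segment_compact.
rewrite (integral_x1 ip)// Rintegral_cst//= lebesgue_measure_itv/= lte_fin.
rewrite -EFinD/=; case: ltgtP x1 => // [x1 _|-> _] /=; by field.
Qed.

Lemma prim_ae u v x : integrable01 u -> integrable01 v ->
  u = v %[ae mu in (`[0, 1]%classic : set R)] -> 0 <= x <= 1 ->
  prim u x = prim v x.
Proof.
move=> iu iv uv /andP[x0 x1].
have sub : `[0, x] `<=` (`[0, 1] : set R) by apply: subset_itvl; rewrite bnd_simp.
rewrite /prim /Rintegral; congr fine; apply: ae_eq_integral => //.
- by apply: measurable_funS sub _ => //; case/integrableP: iu.
- by apply: measurable_funS sub _ => //; case/integrableP: iv.
- by apply: (@filterS _ _ (ae_filter_ringOfSetsType mu) _ _ _ uv) => t /= h /sub/h ->.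
Qed.

Lemma rV2_continuous u : integrable01 u -> {within `[0, 1], continuous (rV2 u)}.
Proof.
move=> iu.
apply: (@subspace_eq_continuous _ _ _ (fun x =>
  prim (prim u) x + (prim u 1 * (1 - x) - prim (prim u) 1) / 2)).
  move=> x; rewrite inE/= in_itv/= => x01.
  by rewrite -rV2E.
apply: within_continuousD.
  exact/prim_continuous/integrable01_continuous/prim_continuous.
apply: derivable_within_continuous => x _; exact: ex_derive.
Qed.

Lemma is_derive_rV2 u x : integrable01 u -> 0 < x < 1 ->
  is_derive x 1 (rV2 u) (prim u x - prim u 1 / 2).
Proof.
move=> iu x01; have cp := prim_continuous iu.
apply: (@near_eq_is_derive _ _ _ (fun x =>
  prim (prim u) x + (prim u 1 * (1 - x) - prim (prim u) 1) / 2)).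
  near=> z; have z01 : 0 < z < 1 by near: z; exact: near01.
  by rewrite rV2E//; lra.
have ? : is_derive x 1 (prim (prim u)) (prim u x).
  apply: (is_derive_prim _ x01); first exact: integrable01_continuous.
  exact: continuous_itv01 cp x01.
apply: is_derive_eq; rewrite /GRing.scale/=; by field.
Unshelve. all: by end_near. Qed.

(** The primitive of [u] depends only on the almost-everywhere class of [u], so it may be
    differentiated as that of the continuous [g]. With U = [prim u 1], the boundary values are k(0)
    = -U/2 and k(1) = U/2 = h(0) + h(1). *)
Lemma bvp_rV2 u g : integrable01 u -> {within `[0, 1], continuous g} ->
  u = g %[ae mu in (`[0, 1]%classic : set R)] ->
  bvp (rV2 u) (fun x => prim u x - prim u 1 / 2) g.
Proof.
move=> iu cg ug; have ig := integrable01_continuous cg; split.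
- exact: rV2_continuous.
- apply: within_continuousB; first exact: prim_continuous.
  exact/continuous_subspaceT/cst_continuous.
- by move=> x; exact: is_derive_rV2.
- move=> x x01; have ? : is_derive x 1 (prim u) (g x).
    apply: near_eq_is_derive (is_derive_prim ig x01 (continuous_itv01 cg x01)).
    near=> z; have z01 : 0 < z < 1 by near: z; exact: near01.
    by rewrite (prim_ae iu ig ug)//; lra.
  by apply: is_derive_eq; rewrite subr0.
- by rewrite !rV2E ?lexx ?ler01// !prim0; split; lra.
Unshelve. all: by end_near. Qed.

Lemma bvp_rV2_continuous g : {within `[0, 1], continuous g} ->
  bvp (rV2 g) (fun x => prim g x - prim g 1 / 2) g.
Proof.
move=> cg; apply: bvp_rV2 => //; [exact: integrable01_continuous|exact: ae_eq_refl].
Qed.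

Lemma is_derive_unique (f : R -> R) x (a b : R) :
  is_derive x 1 f a -> is_derive x 1 f b -> a = b.
Proof. by move=> da db; rewrite -(@derive_val _ _ _ _ _ _ _ da) derive_val. Qed.

(** The primitive of a null function vanishes, while by continuity its derivative at interior points
    is [u]. *)
Lemma continuous_ae0 u : {within `[0, 1], continuous u} ->
  u = cst 0 %[ae mu in (`[0, 1]%classic : set R)] ->
  forall x, 0 <= x <= 1 -> u x = 0.
Proof.
move=> cu u0; have iu := integrable01_continuous cu.
have i0 : integrable01 (cst 0 : R -> R).
  exact/integrable01_continuous/continuous_subspaceT/cst_continuous.
apply: within_continuous0 => // x x01.
apply: is_derive_unique (is_derive_prim iu x01 (continuous_itv01 cu x01)) _.
apply: (@is_derive_near_cst _ _ 0) => // y y01.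
rewrite (prim_ae iu i0 u0) ?/prim; last by lra.
by rewrite Rintegral_cst//= mul0r.
Qed.

(** At a Lebesgue point in ]0,1[ the primitive has derivative [u x], which is 0 for a constant
    primitive; by Lebesgue differentiation almost every point is of this kind. The extension of [u]
    by 0 is locally integrable on the whole line. *)
Lemma prim_cst_ae0 u c : integrable01 u ->
  (forall x, 0 < x < 1 -> prim u x = c) ->
  u = cst 0 %[ae mu in (`[0, 1]%classic : set R)].
Proof.
move=> iu uc; have lu : locally_integrable setT (u \_ `[0, 1]).
  exact: integrable_locally.
have iw : integrable01 (u \_ `[0, 1]).
  apply: eq_integrable iu => // x x01; rewrite /= patchE.
  by rewrite x01.
have key (x : R) : lebesgue_pt (u \_ `[0, 1]) x -> 0 < x < 1 -> u x = 0.
  move=> xl x01; have /andP[x0 x1] := x01.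
  have [|dp pE] := FTC1_lebesgue_pt x1 iw _ xl; first by rewrite (@lte_fin R).
  have -> : u x = (u \_ `[0, 1]) x by rewrite patchE ifT// inE/= in_itv/= !ltW.
  rewrite -pE derive1E; apply: derive_val.
  apply: (@is_derive_near_cst _ _ c) => // z z01.
  rewrite -(uc z z01); apply: eq_prim => [|t t01]; first by lra.
  by rewrite patchE ifT// inE/= in_itv.
(* Single points are negligible, which discards the endpoints 0 and 1. *)
have neq (a : R) : {ae mu, forall x : R, x != a}.
  rewrite /almost_everywhere; apply: (@negligibleS _ _ _ mu [set a]) => [x /= /negP|].
    by rewrite negbK => /eqP.
  by apply/negligibleP => //; exact: lebesgue_measure_set1.
apply: (@filterS3 _ _ (ae_filter_ringOfSetsType mu) _ _ _ _ _
  (lebesgue_differentiation lu) (neq 0) (neq 1)) => x xl x0 x1.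
rewrite /= in_itv/= => /andP[]; rewrite 2!le_eqVlt eq_sym (negbTE x0) (negbTE x1)/=.
by move=> {}x0 {}x1; apply: key => //; rewrite x0.
Qed.

(** Injectivity: [rV2 u] is continuous, so it vanishes on all of [0,1]; its derivative then vanishes
    inside, which makes [prim u] constant there. *)
Lemma rV2_ae0 u : integrable01 u ->
  rV2 u = cst 0 %[ae mu in (`[0, 1]%classic : set R)] ->
  u = cst 0 %[ae mu in (`[0, 1]%classic : set R)].
Proof.
move=> iu /(continuous_ae0 (rV2_continuous iu)) u0.
apply: (@prim_cst_ae0 _ (prim u 1 / 2)) => // x x01; apply/eqP.
rewrite -subr_eq0; apply/eqP; apply: is_derive_unique (is_derive_rV2 iu x01) _.
by apply: (@is_derive_near_cst _ _ 0) => // y y01; apply: u0; lra.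
Qed.

Lemma rV2_cst0 x : 0 <= x <= 1 -> rV2 (cst 0) x = 0.
Proof.
apply: bvp0 (bvp_rV2_continuous _) x => //; exact/continuous_subspaceT/cst_continuous.
Qed.

(** The difference of [rV2 h] and [c^-1 * h] solves the boundary value problem with second
    derivative 0. *)
Lemma bvp_rV2_eigen c h k : c != 0 -> bvp h k (fun x => c * h x) ->
  forall x, 0 <= x <= 1 -> rV2 h x = c^-1 * h x.
Proof.
move=> c0 B x x01; have ch : {within `[0, 1], continuous h} by case: B.
have /bvp0 H := bvp_lin 1 (- c^-1) (bvp_rV2_continuous ch) B.
apply/eqP; rewrite -subr_eq0 -mulNr -[rV2 h x]mul1r; apply/eqP/H => // y _.
by field.
Qed.

Lemma bvp_ae_neq0 c h k x : c != 0 -> bvp h k (fun x => c * h x) ->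
  0 <= x <= 1 -> h x != 0 ->
  ~ h = cst 0 %[ae mu in (`[0, 1]%classic : set R)].
Proof.
move=> c0 [ch _ _ _ _] x01 /eqP hx h0; apply: hx.
exact: continuous_ae0 h0 _ x01.
Qed.

(** The two hypotheses are the real and imaginary parts of h'' = (p + iq) h for h = a + ib; thus a
    non-real constant admits only the zero solution. *)
Lemma bvp_real p q a ka b kb :
  bvp a ka (fun x => p * a x + - q * b x) ->
  bvp b kb (fun x => q * a x + p * b x) -> q != 0 ->
  forall x, 0 <= x <= 1 -> a x = 0 /\ b x = 0.
Proof.
move=> A B q0.
have [cka ckb] : {within `[0, 1], continuous ka} /\ {within `[0, 1], continuous kb}.
  by case: A B => [_ ? _ _ _] [_ ? _ _ _].
have [ca da dka [a01 aE]] : [/\ {within `[0, 1], continuous a},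
    forall x : R, 0 < x < 1 -> is_derive x 1 a (ka x),
    forall x : R, 0 < x < 1 -> is_derive x 1 ka (p * a x + - q * b x) &
    ka 0 = - ka 1 /\ a 0 + a 1 = ka 1] by case: A.
have [cb db dkb [b01 bE]] : [/\ {within `[0, 1], continuous b},
    forall x : R, 0 < x < 1 -> is_derive x 1 b (kb x),
    forall x : R, 0 < x < 1 -> is_derive x 1 kb (q * a x + p * b x) &
    kb 0 = - kb 1 /\ b 0 + b 1 = kb 1] by case: B.
(* The Wronskian of a and b has derivative - q (a^2 + b^2), and equal values at 0
   and 1 by the boundary conditions. *)
pose W x := (ka x * b x - a x * kb x) / q.
have cW : {within `[0, 1], continuous W}.
  apply: within_continuousM; last exact/continuous_subspaceT/cst_continuous.
  by apply: within_continuousB; exact: within_continuousM.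
have dW x : 0 < x < 1 -> is_derive x 1 W (- (a x ^+ 2 + b x ^+ 2)).
  move=> x01; have := da x x01; have := dka x x01.
  have := db x x01; have := dkb x x01 => ? ? ? ?.
  by apply: is_derive_eq; rewrite /GRing.scale/=; field.
have W01 : W 0 = W 1.
  by rewrite /W; congr (_ / _); rewrite a01 b01 -aE -bE; ring.
(* Being nonincreasing with equal end values, [W] is constant, so its derivative, minus a sum of
   squares, is 0. *)
have mW x y : 0 <= x -> x <= y -> y <= 1 -> W y <= W x.
  move=> x0 xy y1; apply: (@ler0_derive1_le_cc _ _ 0 1) => // [z|z||];
    rewrite in_itv/= ?x0 ?y1 ?andbT ?(le_trans x0)//; last exact: le_trans y1.
    by move=> z01; have [] := dW z z01.
  move=> z01; have := dW z z01 => dWz; rewrite derive1E derive_val.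
  by rewrite oppr_le0 addr_ge0 // sqr_ge0.
have cstW x : 0 <= x <= 1 -> W x = W 0.
  move=> /andP[x0 x1]; apply/eqP.
  by rewrite eq_le mW//= W01 mW.
have ab0 x : 0 < x < 1 -> a x = 0 /\ b x = 0.
  move=> x01.
  have d0 : is_derive x 1 W 0.
    by apply: (@is_derive_near_cst _ _ (W 0)) => // y y01; apply: cstW; lra.
  have /eqP := is_derive_unique (dW x x01) d0.
  rewrite oppr_eq0 paddr_eq0 ?sqr_ge0// !sqrf_eq0.
  by move=> /andP[/eqP -> /eqP ->].
by move=> x x01; split; apply: within_continuous0 => // y /ab0[].
Qed.

End RealOperator.

(** * The constants c = 4 t^2 and c = - 4 t^2 for which the problem has a non-zero solution *)

Section Spectrum.
Context {R : realType}.
Implicit Types (h k : R -> R) (c t x : R).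

(** The point where [h] is non-zero must lie in [0,1], since [bvp] says nothing about values
    elsewhere. *)
Definition bvp_eigenvalue c := exists h k x,
  [/\ bvp h k (fun y => c * h y), 0 <= x <= 1 & h x != 0].

Lemma bvp_of_derive c (P Q : R -> R) :
  (forall x : R, is_derive x 1 P (Q x)) ->
  (forall x : R, is_derive x 1 Q (c * P x)) ->
  Q 0 = - Q 1 -> P 0 + P 1 = Q 1 -> bvp P Q (fun x => c * P x).
Proof.
by move=> dP dQ Q01 P01; split => //; apply: derivable_within_continuous => x _;
  [case: (dP x)|case: (dQ x)].
Qed.

(* [P] and [Q] play the roles of the solutions of y'' = c y that are
   respectively even and odd about 1/2. *)
Lemma bvp_eigenvalueP c (P dP Q dQ : R -> R) :
  (forall x : R, is_derive x 1 P (dP x)) ->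
  (forall x : R, is_derive x 1 dP (c * P x)) ->
  (forall x : R, is_derive x 1 Q (dQ x)) ->
  (forall x : R, is_derive x 1 dQ (c * Q x)) ->
  P 0 = P 1 -> dP 0 = - dP 1 -> Q 0 = - Q 1 -> dQ 0 = dQ 1 ->
  (forall x, dP x * Q x - P x * dQ x != 0) ->
  bvp_eigenvalue c <-> dP 1 = 2 * P 1 \/ dQ 1 = 0.
Proof.
move=> DP DdP DQ DdQ P01 dP01 Q01 dQ01 W; split; last first.
  (* Each alternative makes [P] or [Q] itself meet the boundary conditions; it is non-zero at 1,
     where otherwise the Wronskian of [P] and [Q] would vanish. *)
  case=> [dP1|dQ1].
    exists P, dP, 1; split; [|by rewrite ler01 lexx|].
      by apply: bvp_of_derive => //; rewrite P01 dP1; ring.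
    by apply: contraNneq (W 1) => P1; rewrite dP1 P1; apply/eqP; ring.
  exists Q, dQ, 1; split; [|by rewrite ler01 lexx|].
    by apply: bvp_of_derive => //; rewrite ?dQ01 ?Q01 dQ1; ring.
  by apply: contraNneq (W 1) => Q1; rewrite dQ1 Q1; apply/eqP; ring.
case=> h [k [x [B x01 hx]]].
have [<-|dP1] := eqVneq (dP 1) (2 * P 1); [by left|right].
apply: contraNeq hx => dQ1.
have W1 := bvp_wronskian B DP DdP; have W2 := bvp_wronskian B DQ DdQ.
have z01 : 0 <= (0 : R) <= 1 by lra.
have o01 : 0 <= (1 : R) <= 1 by lra.
have [k01 h01] : k 0 = - k 1 /\ h 0 + h 1 = k 1 by case: B.
(* By the symmetries about 1/2, [E1] amounts to (h(0) + h(1)) P'(1) = 2 k(1) P(1) and [E2] to (h(0)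
   - h(1)) Q'(1) = 0. *)
have := W1 0 1 z01 o01; have := W2 0 1 z01 o01.
rewrite k01 P01 dP01 Q01 dQ01 => E2 E1.
have k1 : k 1 = 0.
  have /eqP : k 1 * (dP 1 - 2 * P 1) = 0 by rewrite -h01 in E1 *; lra.
  by rewrite mulf_eq0 subr_eq0 (negbTE dP1) orbF => /eqP.
have h1 : h 1 = 0.
  have h0 : h 0 = - h 1 by lra.
  have /eqP : h 1 * dQ 1 = 0 by rewrite h0 k1 in E2; lra.
  by rewrite mulf_eq0 (negbTE dQ1) orbF => /eqP.
(* Since h(1) = k(1) = 0, both Wronskians with [h] vanish throughout [0,1]; eliminating [k x] leaves
   [h x] times the non-zero Wronskian of [P] and [Q]. *)
have /eqP : h x * (dP x * Q x - P x * dQ x) = 0.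
  have := W1 x 1 x01 o01; have := W2 x 1 x01 o01; rewrite h1 k1 => F2 F1.
  transitivity ((h x * dP x - k x * P x) * Q x - (h x * dQ x - k x * Q x) * P x).
    by ring.
  by rewrite F1 F2; ring.
by rewrite mulf_eq0 (negbTE (W x)) orbF.
Qed.

Lemma is_derive_cosh x : is_derive x 1 (@cosh R) (sinh x).
Proof.
have ? := @is_derive1_comp R expR -%R x _ _ (is_derive_expR _) (is_deriveNid _ _).
rewrite /cosh /sinh; apply: is_derive_eq; rewrite /GRing.scale/=; ring.
Qed.

Lemma is_derive_sinh x : is_derive x 1 (@sinh R) (cosh x).
Proof.
have ? := @is_derive1_comp R expR -%R x _ _ (is_derive_expR _) (is_deriveNid _ _).
rewrite /cosh /sinh; apply: is_derive_eq; rewrite /GRing.scale/=; ring.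
Qed.

Lemma coshN x : cosh (- x) = cosh x.
Proof. by rewrite /cosh opprK addrC. Qed.

Lemma sinhN x : sinh (- x) = - sinh x.
Proof. by rewrite /sinh opprK -mulNr opprB. Qed.

Lemma cosh2Bsinh2 x : cosh x ^+ 2 - sinh x ^+ 2 = 1.
Proof.
rewrite /cosh /sinh.
have := expRxMexpNx_1 x; move: (expR x) (expR (- x)) => a b ab.
by transitivity (a * b); [field|].
Qed.

Lemma cosh_gt0 x : 0 < cosh x.
Proof. by rewrite divr_gt0// addr_gt0// expR_gt0. Qed.

Lemma sinh_gt0 t : 0 < t -> 0 < sinh t.
Proof. by move=> t0; rewrite divr_gt0// subr_gt0 ltr_expR; lra. Qed.

Lemma is_derive_affine_comp (f : R -> R) (f' a b x : R) :
  is_derive (a * x - b) 1 f f' -> is_derive x 1 (fun y => f (a * y - b)) (a * f').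
Proof.
move=> df; have ? : is_derive x 1 (fun y => a * y - b) a.
  by apply: is_derive_eq; rewrite /GRing.scale/=; ring.
by rewrite mulrC; exact: (@is_derive1_comp _ f (fun y => a * y - b)).
Qed.

(** The even solution gives t sinh t = cosh t; the odd one would require cosh t = 0, which is
    impossible. *)
Lemma bvp_eigenvalue_gt0 t : 0 < t ->
  bvp_eigenvalue (4 * t ^+ 2) <-> coth t / t = 1.
Proof.
move=> t0.
(* The factor [a] covers both a solution ([a] = 1) and the derivative of the other one ([a] = 2t);
   hence the [1 *] in the functions supplied below. *)
have dS (x a : R) : is_derive x 1 (fun y => a * sinh (2 * t * y - t))
    (a * (2 * t * cosh (2 * t * x - t))).
  have ? := is_derive_affine_comp (is_derive_sinh (2 * t * x - t)).
  by apply: is_derive_eq; rewrite /GRing.scale/=; ring.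
have dC (x a : R) : is_derive x 1 (fun y => a * cosh (2 * t * y - t))
    (a * (2 * t * sinh (2 * t * x - t))).
  have ? := is_derive_affine_comp (is_derive_cosh (2 * t * x - t)).
  by apply: is_derive_eq; rewrite /GRing.scale/=; ring.
have e0 : 2 * t * 0 - t = - t by ring.
have e1 : 2 * t * 1 - t = t by ring.
apply: iff_trans; first apply: (@bvp_eigenvalueP _
  (fun x => 1 * cosh (2 * t * x - t)) (fun x => (2 * t) * sinh (2 * t * x - t))
  (fun x => 1 * sinh (2 * t * x - t)) (fun x => (2 * t) * cosh (2 * t * x - t))).
- move=> x; apply: is_derive_eq (dC x 1) _; ring.
- move=> x; apply: is_derive_eq (dS x (2 * t)) _; ring.
- move=> x; apply: is_derive_eq (dS x 1) _; ring.
- move=> x; apply: is_derive_eq (dC x (2 * t)) _; ring.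
- by rewrite e0 e1 coshN.
- by rewrite e0 e1 sinhN mulrN.
- by rewrite e0 e1 sinhN mulrN.
- by rewrite e0 e1 coshN.
- move=> x; have := cosh2Bsinh2 (2 * t * x - t); set C := cosh _; set S := sinh _ => E.
  have -> : 2 * t * S * (1 * S) - 1 * C * (2 * t * C) =
      - (2 * t) * (C ^+ 2 - S ^+ 2) by ring.
  by rewrite E mulr1 oppr_eq0 gt_eqF//; lra.
- rewrite /= e1 /coth; split=> [[E|/eqP]|E].
  + have := cosh_gt0 t; have := sinh_gt0 t0 => *; apply/eqP; rewrite -subr_eq0; apply/eqP.
    have -> : cosh t = t * sinh t by lra.
    by field; rewrite ?gt_eqF.
  + by rewrite mulf_eq0 !gt_eqF ?cosh_gt0//; lra.
  + left; have := sinh_gt0 t0 => s0.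
    have -> : cosh t = cosh t / sinh t / t * (t * sinh t) by field; rewrite ?gt_eqF.
    by rewrite E; ring.
Qed.

(** The even solution gives t sin t = - cos t, and the odd one gives cos t = 0, which is now
    possible. *)
Lemma bvp_eigenvalue_lt0 t : 0 < t ->
  bvp_eigenvalue (- (4 * t ^+ 2)) <-> cot t / t = -1 \/ cos t = 0.
Proof.
move=> t0.
have dS (x a : R) : is_derive x 1 (fun y => a * sin (2 * t * y - t))
    (a * (2 * t * cos (2 * t * x - t))).
  have ? := is_derive_affine_comp (is_derive_sin (2 * t * x - t)).
  by apply: is_derive_eq; rewrite /GRing.scale/=; ring.
have dC (x a : R) : is_derive x 1 (fun y => a * cos (2 * t * y - t))
    (a * - (2 * t * sin (2 * t * x - t))).
  have ? := is_derive_affine_comp (is_derive_cos (2 * t * x - t)).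
  by apply: is_derive_eq; rewrite /GRing.scale/=; ring.
have e0 : 2 * t * 0 - t = - t by ring.
have e1 : 2 * t * 1 - t = t by ring.
apply: iff_trans; first apply: (@bvp_eigenvalueP _
  (fun x => 1 * cos (2 * t * x - t)) (fun x => (- (2 * t)) * sin (2 * t * x - t))
  (fun x => 1 * sin (2 * t * x - t)) (fun x => (2 * t) * cos (2 * t * x - t))).
- move=> x; apply: is_derive_eq (dC x 1) _; ring.
- move=> x; apply: is_derive_eq (dS x (- (2 * t))) _; ring.
- move=> x; apply: is_derive_eq (dS x 1) _; ring.
- move=> x; apply: is_derive_eq (dC x (2 * t)) _; ring.
- by rewrite e0 e1 cosN.
- by rewrite e0 e1 sinN; ring.
- by rewrite e0 e1 sinN mulrN.
- by rewrite e0 e1 cosN.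
- move=> x; have := cos2Dsin2 (2 * t * x - t); set C := cos _; set S := sin _ => E.
  have -> : - (2 * t) * S * (1 * S) - 1 * C * (2 * t * C) =
      - (2 * t) * (C ^+ 2 + S ^+ 2) by ring.
  by rewrite E mulr1 oppr_eq0 gt_eqF//; lra.
- rewrite /= e1 /cot; split=> [[E|/eqP]|[E|->]]; last by right; rewrite mulr0.
  + left; have E' : cos t = - (t * sin t) by lra.
    have s0 : sin t != 0.
      apply: contra_eq_neq (cos2Dsin2 t) => s0; rewrite E' s0.
      by rewrite mulr0 oppr0 expr0n/= addr0 eq_sym oner_eq0.
    by rewrite E'; field; rewrite s0 gt_eqF.
  + by rewrite mulf_eq0 gt_eqF ?mulr_gt0//= => /eqP; right.
  (* Where sin t = 0, [cot t] is 0 by convention, so the equation with right-hand side -1 admits no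
     such [t]. *)
  + left; have [s0|s0] := eqVneq (sin t) 0.
      by move: E; rewrite s0 invr0 mulr0 mul0r; lra.
    have -> : cos t = cos t / sin t / t * (t * sin t) by field; rewrite s0 gt_eqF.
    by rewrite E; ring.
Qed.

Lemma sin_mulrz_pi (n : int) : sin (n%:~R * pi) = 0 :> R.
Proof.
have sn (m : nat) : sin (m%:R * pi) = 0 :> R.
  by rewrite mulr_natl -[pi *+ m]add0r (alternatingn (@sinDpi R)) sin0 mulr0.
by case: n => m; rewrite ?NegzE ?mulrNz ?mulNr ?sinN -?pmulrn sn ?oppr0.
Qed.

Lemma cos_eq0 t : 0 < t -> cos t = 0 <->
  exists n : int, 4 * t ^+ 2 = (2 * n%:~R + 1) ^+ 2 * pi ^+ 2.
Proof.
have pi0 := @pi_gt0 R; move=> t0; split=> [ct|[n E]].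
  (* Subtracting m pi moves [t] into [0, pi] and changes the cosine only by a sign; cosine is
     injective there, so the remainder is pi/2. *)
  pose m := Num.truncn (t / pi); exists (m%:Z).
  have /andP[m1 m2] : m%:R <= t / pi < m.+1%:R by apply: truncn_itv; rewrite divr_ge0 ?ltW.
  have tE : t - m%:R * pi + pi *+ m = t by rewrite -mulr_natl; ring.
  have r0 : 0 <= t - m%:R * pi by rewrite subr_ge0 -ler_pdivlMr.
  have r1 : t - m%:R * pi <= pi.
    have : t <= m.+1%:R * pi by rewrite -ler_pdivrMr// ltW.
    by rewrite -natr1; lra.
  have : cos (t - m%:R * pi) = cos (pi / 2).
    rewrite cos_pihalf; apply/eqP; move: ct; rewrite -{1}tE (alternatingn (@cosDpi R)).
    by move=> /eqP; rewrite mulf_eq0 signr_eq0.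
  move=> /cos_inj; rewrite !in_itv/= r0 r1 => H.
  have -> : t = m%:R * pi + pi / 2 by rewrite -H//; [ring|lra].
  by rewrite -pmulrn; field.
have : (2 * t) ^+ 2 == ((2 * n%:~R + 1) * pi) ^+ 2 by apply/eqP; rewrite !exprMn -E; ring.
have cn : cos (n%:~R * pi + pi / 2) = 0 :> R by rewrite cosDpihalf sin_mulrz_pi oppr0.
(* The integer [n] may be negative, so [t] is n pi + pi/2 up to sign; evenness of cosine settles the
   second case. *)
rewrite eqf_sqr => /orP[] /eqP {}E.
  by rewrite -cn; congr cos; lra.
by rewrite -cn -cosN; congr cos; lra.
Qed.

End Spectrum.

(** * Transfer between complex square-integrable functions and their real and imaginary parts *)

Section ComplexOperator.
Context {R : realType}.
Local Notation mu := (@lebesgue_measure R).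
Implicit Types (f : R -> R[i]).

Lemma mulcE (a b c d : R) :
  (a +i* b) * (c +i* d) = (a * c - b * d) +i* (a * d + b * c).
Proof. by []. Qed.

(** Integration is componentwise by definition, so only the division by the complex number 2 needs
    an argument. *)
Lemma Re_volterra2E f x : Re_volterra2 f x =
  (rV2 (fun t => complex.Re (f t)) x) +i* (rV2 (fun t => complex.Im (f t)) x).
Proof.
have half (a b : R) : (a +i* b) / 2 = (a / 2) +i* (b / 2).
  have n2 : (2 : R[i]) != 0 by rewrite pnatr_eq0.
  apply: (mulIf n2); rewrite divfK//.
  have -> : (2 : R[i]) = 2 +i* 0 by rewrite -[RHS]/(2%:C) rmorphMn rmorph1.
  by rewrite mulcE; congr (_ +i* _); field.
exact: half.
Qed.

Lemma normc2E (z : R[i]) :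
  Normc.normc z ^+ 2 = complex.Re z ^+ 2 + complex.Im z ^+ 2.
Proof. by case: z => a b /=; rewrite sqr_sqrtr// addr_ge0// sqr_ge0. Qed.

(** Each component [w] satisfies |w| <= 1 + w^2 <= 1 + |f|^2, and constants are integrable on
    [0,1]. *)
Lemma L2_01_integrable f : L2_01 f ->
  integrable01 (fun x => complex.Re (f x)) /\
  integrable01 (fun x => complex.Im (f x)).
Proof.
move=> [[mr mi] foo].
pose n2 := fun x => Normc.normc (f x) ^+ 2.
have mn : measurable_fun (`[0, 1]%classic : set R) n2.
  apply: (@eq_measurable_fun _ _ _ _ _
    (fun x => complex.Re (f x) ^+ 2 + complex.Im (f x) ^+ 2)).
    by move=> x _; rewrite /n2 normc2E.
  by apply: measurable_funD; exact: measurable_funX.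
have i1 : integrable01 (cst 1 : R -> R).
  exact/integrable01_continuous/continuous_subspaceT/cst_continuous.
have ig : mu.-integrable `[0, 1] (fun x => (1%:E + (n2 x)%:E)%E).
  apply: integrableD => //.
  apply/integrableP; split; first exact/measurable_EFinP.
  under eq_integral => x _ do rewrite /= ger0_norm ?sqr_ge0//.
  exact: foo.
have key (w : R -> R) : measurable_fun (`[0, 1]%classic : set R) w ->
    (forall x, w x ^+ 2 <= n2 x) -> integrable01 w.
  move=> mw wn; apply: le_integrable ig => //; first exact/measurable_EFinP.
  move=> x _; rewrite -EFinD /= lee_fin (@ger0_norm _ (1 + n2 x)) ?addr_ge0 ?sqr_ge0//.
  by have := wn x; rewrite ler_norml; nra.
split; apply: key => // x; rewrite /n2 normc2E.
  by rewrite lerDl sqr_ge0.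
by rewrite lerDr sqr_ge0.
Qed.

Lemma L2_01_continuous (h : R -> R) : {within `[0, 1], continuous h} ->
  L2_01 (fun x => (h x)%:C).
Proof.
move=> ch; split.
  by split; [exact: subspace_continuous_measurable_fun|exact: measurable_cst].
have /integrableP[_] := integrable01_continuous (within_continuousM ch ch).
rewrite (_ : (\int[mu]_(x in _) _)%E =
  (\int[mu]_(x in `[0%R, 1%R]) (Normc.normc (h x)%:C ^+ 2)%:E)%E)//.
apply: eq_integral => x _.
by rewrite normc2E/= expr0n addr0 -expr2 ger0_norm ?sqr_ge0.
Qed.

Lemma eigenvalue_bvp c : c != 0 -> bvp_eigenvalue c ->
  is_eigenvalue (@Re_volterra2 R) (c^-1)%:C.
Proof.
move=> c0 [h [k [x [B x01 hx]]]]; exists (fun y => (h y)%:C); split.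
- by apply: L2_01_continuous; case: B.
- move=> h0; apply: (bvp_ae_neq0 c0 B x01 hx).
  by apply: (@filterS _ _ (ae_filter_ringOfSetsType mu) _ _ _ h0) => y /= H /H[].
- apply: aeW => y /=; rewrite in_itv/= => y01; rewrite Re_volterra2E/=.
  rewrite (bvp_rV2_eigen c0 B y01) rV2_cst0// mulcE.
  by congr (_ +i* _); ring.
Qed.

(** The eigenfunction [f] is known only almost everywhere, so the solution of the boundary value
    problem is taken from its image under the operator, which is continuous and proportional to [f]
    almost everywhere. *)
Lemma bvp_of_eigenvalue lambda : is_eigenvalue (@Re_volterra2 R) lambda ->
  exists c, [/\ c != 0, bvp_eigenvalue c & lambda = (c^-1)%:C].
Proof.
move=> [f [/L2_01_integrable[]]].
set u := fun x => complex.Re (f x); set v := fun x => complex.Im (f x).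
move=> iu iv fn0 feig.
have F := ae_filter_ringOfSetsType mu.
have fuv : u = cst 0 %[ae mu in (`[0, 1]%classic : set R)] ->
    v = cst 0 %[ae mu in (`[0, 1]%classic : set R)] -> False.
  move=> u0 v0; apply: fn0; apply: (@filterS2 _ _ F _ _ _ _ u0 v0) => x Hu Hv x01.
  by have := Hu x01; have := Hv x01; rewrite /u /v; case: (f x) => a b /= -> ->.
have [l0|l0] := eqVneq lambda 0.
  exfalso; apply: fuv; apply: rV2_ae0 => //;
    apply: (@filterS _ _ F _ _ _ feig) => x H x01; move: (H x01);
    by rewrite l0 mul0r Re_volterra2E => -[].
have := erefl lambda^-1; case: {2}(lambda^-1) => p q lE.
pose a := rV2 u; pose b := rV2 v.
have uv x : Re_volterra2 f x = lambda * f x ->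
    u x = p * a x - q * b x /\ v x = q * a x + p * b x.
  move=> E; have Efx : f x = (p * a x - q * b x) +i* (p * b x + q * a x).
    by rewrite -[f x](mulKf l0) -E lE Re_volterra2E.
  by rewrite /u /v Efx /= [q * _ + _]addrC.
have ca : {within `[0, 1], continuous a} by exact: rV2_continuous.
have cb : {within `[0, 1], continuous b} by exact: rV2_continuous.
have ug : u = (fun x => p * a x + - q * b x) %[ae mu in (`[0, 1]%classic : set R)].
  by apply: (@filterS _ _ F _ _ _ feig) => x H /H/uv[->]; rewrite mulNr.
have vg : v = (fun x => q * a x + p * b x) %[ae mu in (`[0, 1]%classic : set R)].
  by apply: (@filterS _ _ F _ _ _ feig) => x H /H/uv[].
have Ba := bvp_rV2 iu (@within_continuous_lin _ _ a b p (- q) ca cb) ug.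
have Bb := bvp_rV2 iv (@within_continuous_lin _ _ a b q p ca cb) vg.
(* If [a] and [b] both vanished on [0,1], then [f] would be 0 almost everywhere. *)
have [x [x01 abx]] : exists x, 0 <= x <= 1 /\ ~ (a x = 0 /\ b x = 0).
  apply: contrapT => H.
  have ab0 x : 0 <= x <= 1 -> a x = 0 /\ b x = 0.
    by move=> x01; apply: contrapT => H'; apply: H; exists x.
  apply: fuv.
    apply: (@filterS _ _ F _ _ _ ug) => x H' x01; rewrite H'//.
    by have [-> ->] := ab0 x x01; rewrite !mulr0 addr0.
  apply: (@filterS _ _ F _ _ _ vg) => x H' x01; rewrite H'//.
  by have [-> ->] := ab0 x x01; rewrite !mulr0 addr0.
have q0 : q = 0 by apply/eqP; apply: contra_notT abx => q0; exact: bvp_real Ba Bb q0 _ x01.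
have lE' : lambda = (p^-1)%:C by rewrite -[lambda]invrK lE q0 -[_ +i* 0]/(p%:C) fmorphV.
exists p; split => //.
  by apply: contra_neq l0; rewrite lE' => ->; rewrite invr0.
(* For q = 0 the system decouples, so whichever of [a] and [b] is non-zero at [x] is a solution for
   [p]. *)
have [a0|a0] := eqVneq (a x) 0.
  exists b, (fun x => prim v x - prim v 1 / 2), x; split => //.
    rewrite (_ : (fun y => p * b y) = fun y => q * a y + p * b y)//.
    by apply/funext => y; rewrite q0 mul0r add0r.
  by apply/eqP => b0; apply: abx.
exists a, (fun x => prim u x - prim u 1 / 2), x; split => //.
rewrite (_ : (fun y => p * a y) = fun y => p * a y + - q * b y)//.
by apply/funext => y; rewrite q0 oppr0 mul0r addr0.
Qed.

End ComplexOperator.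

Theorem theorem2p5 (R : realType) :
  [set lambda : R[i] | is_eigenvalue (@Re_volterra2 R) lambda] =
     [set (1 / (4 * t ^+ 2))%:C | t in [set t : R | 0 < t /\ coth t / t = 1]]
 `|` [set (- (1 / (4 * t ^+ 2)))%:C | t in [set t : R | 0 < t /\ cot t / t = -1]]
 `|` [set (- (1 / ((2 * n%:~R + 1) ^+ 2 * pi ^+ 2)))%:C | n in [set: int]].
Proof.
have pos (t : R) : 0 < t -> 4 * t ^+ 2 != 0.
  by move=> t0; rewrite mulf_neq0 ?expf_neq0 ?gt_eqF.
have sqrt4 (c : R) : 0 < c -> exists2 t, 0 < t & c = 4 * t ^+ 2.
  move=> c0; exists (Num.sqrt c / 2); first by rewrite divr_gt0 ?sqrtr_gt0.
  by rewrite exprMn sqr_sqrtr ?ltW//; field.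
apply/seteqP; split => [lambda /= /bvp_of_eigenvalue[c [c0 ec ->]]|lambda /=].
  (* A positive [c] leads to the first family, a negative one to the second or the third. *)
  have [cpos|cneg|cE] := ltgtP 0 c; last by rewrite -cE eqxx in c0.
    have [t t0 cE] := sqrt4 c cpos; left; left; exists t; last by rewrite div1r cE.
    by split => //; apply/(bvp_eigenvalue_gt0 t0); rewrite -cE.
  have [|t t0 cE] := sqrt4 (- c); first by rewrite oppr_gt0.
  have cE' : c = - (4 * t ^+ 2) by rewrite -cE opprK.
  move: ec; rewrite cE' => /(bvp_eigenvalue_lt0 t0)[ct|/(cos_eq0 t0)[n nE]].
    by left; right; exists t => //; rewrite div1r invrN.
  by right; exists n => //; rewrite -nE div1r invrN.
case=> [[|]|] [].
- move=> t [t0 /(bvp_eigenvalue_gt0 t0) et] <-.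
  by rewrite div1r; apply: eigenvalue_bvp => //; exact: pos.
- move=> t [t0 ct] <-; rewrite div1r -invrN; apply: eigenvalue_bvp.
    by rewrite oppr_eq0; exact: pos.
  by apply/(bvp_eigenvalue_lt0 t0); left.
- move=> n _ <-; rewrite div1r -invrN -exprMn.
  have odd0 : 2 * n%:~R + 1 != 0 :> R.
    rewrite (_ : 2 * n%:~R + 1 = (2 * n + 1)%:~R); last by rewrite intrD intrM.
    by rewrite intr_eq0; lia.
  have n0 : (2 * n%:~R + 1) * pi != 0 :> R by exact: mulf_neq0 odd0 (lt0r_neq0 (pi_gt0 R)).
  (* This [t] is |2n+1| pi/2, a positive zero of cosine; it is positive because 2n+1 is odd, hence
     non-zero. *)
  have [|t t0 tE] := sqrt4 (((2 * n%:~R + 1) * pi) ^+ 2).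
    by rewrite exprn_even_gt0.
  apply: eigenvalue_bvp; first by rewrite oppr_eq0 expf_neq0.
  rewrite tE; apply/(bvp_eigenvalue_lt0 t0); right; apply/(cos_eq0 t0).
  by exists n; rewrite -tE exprMn.
Qed.
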